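(* Let $P$ be a poset. The inclusion map $\gamma\colon P\hookrightarrow F(P)$ is a fusion-completion of $P$.
   Context: In a poset $P$, $x\circ y$ (overlap) means that there is $z\in P$ with $z\le x$ and $z\le y$. For $A\subseteq P$, $\downarrow A=\{y\in P\mid y\le a\text{ for some }a\in A\}$. For $\varnothing\ne A\subseteq P$, an element $x\in P$ is a fusion of $A$ if for every $y\in P$: $y\circ x$ if and only if $y\circ z$ for some $z\in A$. A poset is fusion-complete if every nonempty subset has a fusion. An order-embedding is a map $f$ with $x\le y\iff f(x)\le f(y)$. A map $f\colon P\to M$ is: $\circ$-reflecting if $f(x)\circ f(y)$ implies $x\circ y$; fusion-preserving if $f(x)$ is a fusion of $f(A)$ in $M$ whenever $x\in P$ is a fusion of $A\subseteq P$; fusion-dense if for every $m\in M$ there is $A\subseteq P$ such that $m$ is a fusion of $f(A)$ in $M$. A fusion-completion of $P$ is a fusion-complete poset $M$ together with a $\circ$-reflecting, fusion-preserving and fusion-dense order-embedding $e\colon P\to M$. $F(P)$ is the set $P\cup\{f_A\mid \varnothing\neq A\subseteq P\text{ has no fusion in }P\}$, where the $f_A$ are new, pairwise distinct formal elements not in $P$, one for each such $A$. Its order is: on $P$ the given order; each $f_A\le f_A$; for $x\in P$, $x\le f_A$ iff $x\in\downarrow A$; distinct $f_A$, $f_B$ are incomparable; and no $f_A$ is below an element of $P$. *)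

(* Defs.v *)
From HB Require Import structures.
From mathcomp Require Import all_boot all_order.
From mathcomp Require Import boolp classical_sets.

Set Implicit Arguments.
Unset Strict Implicit.
Unset Printing Implicit Defensive.

Import Order.TTheory.
Local Open Scope classical_set_scope.
Local Open Scope order_scope.

Section Fusion.
Context {d : Order.disp_t} {P : porderType d}.
Implicit Types (x y : P) (A : set P).

Definition overlap x y : Prop := exists z : P, z <= x /\ z <= y.

Definition is_fusion A x : Prop :=
  A !=set0 /\
  forall y, overlap y x <-> exists z, A z /\ overlap y z.

Definition has_fusion A : Prop := exists x, is_fusion A x.

End Fusion.

Definition fusion_complete {d : Order.disp_t} (P : porderType d) : Prop :=
  forall A : set P, A !=set0 -> has_fusion A.

Section FusionMaps.
Context {d d' : Order.disp_t} {P : porderType d} {M : porderType d'}.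
Implicit Type f : P -> M.

Definition order_embedding f : Prop := {mono f : x y / x <= y}.

Definition overlap_reflecting f : Prop :=
  forall x y, overlap (f x) (f y) -> overlap x y.

Definition fusion_preserving f : Prop :=
  forall (A : set P) (x : P), is_fusion A x -> is_fusion (f @` A) (f x).

Definition fusion_dense f : Prop :=
  forall m : M, exists A : set P, is_fusion (f @` A) m.

End FusionMaps.

Definition fusion_completion {d d' : Order.disp_t} (P : porderType d)
    (M : porderType d') (e : P -> M) : Prop :=
  [/\ fusion_complete M, order_embedding e, overlap_reflecting e,
      fusion_preserving e & fusion_dense e].

(* [formal A] is the formal element f_A. The second component of
   [fusionless P] is a Prop, so by proof irrelevance there is exactly one f_A
   for each nonempty subset A without a fusion. *)
Definition fusionless {d : Order.disp_t} (P : porderType d) : Type :=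
  {A : set P | A !=set0 /\ ~ has_fusion A}.

Inductive freeF {d : Order.disp_t} (P : porderType d) : Type :=
| incl of P
| formal of fusionless P.

Arguments incl {d P}.
Arguments formal {d P}.

Section FreeFOrder.
Context {d : Order.disp_t} {P : porderType d}.
Implicit Types u v w : freeF P.

Definition freeF_le u v : bool :=
  match u, v with
  | incl x, incl y => x <= y
  | incl x, formal A => `[< down (sval A) x >]
  | formal _, incl _ => false
  | formal A, formal B => `[< A = B >]
  end.

Lemma freeF_le_refl : reflexive freeF_le.
Proof. by case=> [x|A] /=; [exact: lexx | exact/asboolP]. Qed.

Lemma freeF_le_anti : antisymmetric freeF_le.
Proof.
case=> [x|A] [y|B] //=.
- by move=> /le_anti ->.
- by rewrite andbF.
- by case/andP => /asboolP ->.
Qed.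

Lemma freeF_le_trans : transitive freeF_le.
Proof.
case=> [y|B] [x|A] [z|C] //=.
- exact: le_trans.
- move=> xy /asboolP [a [Aa ya]]; apply/asboolP.
  by exists a; split=> //; exact: le_trans ya.
- by move=> xB /asboolP <-.
- by move=> /asboolP -> /asboolP ->; exact/asboolP.
Qed.

(* Classical choice equips every type with these structures, so posets lose no
   generality by being [porderType]s. *)
HB.instance Definition _ := gen_eqMixin (freeF P).
HB.instance Definition _ := gen_choiceMixin (freeF P).
HB.instance Definition _ := Order.Le_isPOrder.Build d (freeF P)
  freeF_le_refl freeF_le_anti freeF_le_trans.

End FreeFOrder.

(* Main.v *)
Require Import Defs.
From mathcomp Require Import all_boot all_order.
From mathcomp Require Import boolp classical_sets.

(** Every element of [freeF P] has an element of [P] below it, because the set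
    [A] indexing a formal element is nonempty. So overlap in [freeF P] is
    always witnessed in [P] ([overlap_freeFP]). Consequently fusions in [P]
    remain fusions in [freeF P] ([incl_fusion_preserving]), and [formal A] is a
    fusion of the image of [A] ([is_fusion_formal]); since [x] is a fusion of
    its singleton, this gives fusion-density. For completeness, take the trace
    of a nonempty set [S] of elements of [freeF P], that is, the set of elements
    of [P] lying below some member of [S]. Any fusion of the trace in [freeF P]
    is a fusion of [S] ([fusion_of_trace]), and the trace has one: its fusion
    in [P] if that exists, and otherwise the formal element that it indexes. *)

Set Implicit Arguments.
Unset Strict Implicit.
Unset Printing Implicit Defensive.

Import Order.TTheory.
Local Open Scope classical_set_scope.
Local Open Scope order_scope.

Section FreeFusion.
Context {d : Order.disp_t} {P : porderType d}.
Implicit Types (x y : P) (u v m : freeF P) (S : set (freeF P)).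

Lemma incl_leE x y : (incl x <= incl y :> freeF P) = (x <= y).
Proof. by []. Qed.

Lemma incl_le_formalP x (B : fusionless P) :
  (incl x <= formal B :> freeF P) <-> exists2 a, sval B a & x <= a.
Proof.
split; first by move=> /asboolP [a [Ba xa]]; exists a.
by move=> [a Ba xa]; apply/asboolP; exists a.
Qed.

Lemma incl_below u : exists p, incl p <= u.
Proof.
case: u => [x|B]; first by exists x; exact: lexx.
have [[a Ba] _] := svalP B.
by exists a; apply/incl_le_formalP; exists a.
Qed.

Lemma overlap_freeFP u v :
  overlap u v <-> exists p, incl p <= u /\ incl p <= v.
Proof.
split=> [[w [wu wv]]|[p [pu pv]]]; last by exists (incl p).
have [p pw] := incl_below w.
by exists p; split; exact: le_trans pw _.
Qed.

Lemma overlap_incl x y : overlap (incl x) (incl y) <-> overlap x y.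
Proof. exact: overlap_freeFP. Qed.

Lemma incl_fusion_preserving : fusion_preserving (incl : P -> freeF P).
Proof.
move=> A x [[a Aa] Ax]; split; first by exists (incl a); exists a.
move=> v; split.
  move=> /overlap_freeFP [p [pv px]].
  have /Ax [b [Ab [q [qp qb]]]] : overlap p x by exists p; split.
  exists (incl b); split; first by exists b.
  apply/overlap_freeFP; exists q; split=> //.
  by apply: le_trans pv; rewrite incl_leE.
move=> [_ [[b Ab <-]]] /overlap_freeFP [p [pv pb]].
have /Ax [q [qp qx]] : exists z, A z /\ overlap p z.
  by exists b; split=> //; exists p; split.
apply/overlap_freeFP; exists q; split=> //.
by apply: le_trans pv; rewrite incl_leE.
Qed.

Lemma is_fusion_formal (B : fusionless P) :
  is_fusion (incl @` sval B) (formal B).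
Proof.
have [[a0 Ba0] _] := svalP B.
split; first by exists (incl a0); exists a0.
move=> v; split.
  move=> /overlap_freeFP [p [pv /incl_le_formalP [a Ba pa]]].
  exists (incl a); split; first by exists a.
  by apply/overlap_freeFP; exists p.
move=> [_ [[a Ba <-]]] /overlap_freeFP [p [pv pa]].
by apply/overlap_freeFP; exists p; split=> //; apply/incl_le_formalP; exists a.
Qed.

(** The elements of [P] that lie below some member of [S]. *)
Definition trace S : set P := [set p | exists2 u, S u & incl p <= u].

Lemma trace_nonempty S : S !=set0 -> trace S !=set0.
Proof. by move=> [u Su]; have [p pu] := incl_below u; exists p; exists u. Qed.

Lemma fusion_of_trace S m : is_fusion (incl @` trace S) m -> is_fusion S m.
Proof.
move=> [[_ [_ [u0 Su0 _] _]] Sm]; split; first by exists u0.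
move=> v; rewrite Sm; split.
  move=> [_ [[p [u Su pu] <-] [w [wv wp]]]].
  by exists u; split=> //; exists w; split=> //; exact: le_trans wp pu.
move=> [u [Su /overlap_freeFP [p [pv pu]]]].
exists (incl p); split; first by exists p => //; exists u.
by exists (incl p).
Qed.

Lemma freeF_fusion_complete : fusion_complete (freeF P).
Proof.
move=> S /trace_nonempty S0.
have [[x Sx]|nS] := pselect (has_fusion (trace S)).
  by exists (incl x); apply/fusion_of_trace/incl_fusion_preserving.
pose B : fusionless P := exist _ (trace S) (conj S0 nS).
by exists (formal B); apply: fusion_of_trace; exact: is_fusion_formal B.
Qed.

Lemma is_fusion_set1 x : is_fusion [set x] x.
Proof.
split; first by exists x.
by move=> y; split=> [yx|[_ [-> //]]]; exists x.
Qed.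

Lemma incl_fusion_dense : fusion_dense (incl : P -> freeF P).
Proof.
case=> [x|B]; last by exists (sval B); exact: is_fusion_formal.
by exists [set x]; apply: incl_fusion_preserving; exact: is_fusion_set1.
Qed.

End FreeFusion.

Theorem theorem6p1 (d : Order.disp_t) (P : porderType d) :
  fusion_completion (incl : P -> freeF P).
Proof.
split.
- exact: freeF_fusion_complete.
- exact: incl_leE.
- by move=> x y /overlap_incl.
- exact: incl_fusion_preserving.
- exact: incl_fusion_dense.
Qed.
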